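(* Let $m\ge 1$ and let $Q$ be a subdirectly irreducible $m$-reductive medial quandle. Then: \begin{itemize} \item if $m=1$, then $|Q|=2$; \item if $m\geq 2$ (and $Q$ is not a projection quandle), then $Q$ is isomorphic to $\mathcal{SIQ}(A,t,C)$ for some subdirectly irreducible $\mathbb{Z}[t,t^{-1}]/(1-t)^{m-1}$-module $A$ and some admissible set $C$. \end{itemize}
   Context: A quandle is an algebra $(Q,\ast,\backslash)$ with two binary operations such that for all $x,y,z\in Q$: $x\ast x=x$; $x\ast(y\ast z)=(x\ast y)\ast(x\ast z)$; $x\backslash(x\ast y)=y=x\ast(x\backslash y)$. It is medial if for all $x,y,u,v$: $(x\ast y)\ast(u\ast v)=(x\ast u)\ast(y\ast v)$, $(x\backslash y)\backslash(u\backslash v)=(x\backslash u)\backslash(y\backslash v)$ and $(x\backslash y)\ast(u\backslash v)=(x\ast u)\backslash(y\ast v)$. A projection quandle is one satisfying $x\ast y=y$ for all $x,y$. For $m\ge 1$, a quandle is $m$-reductive if it satisfies the identity $(((x\ast y)\ast y)\ast\cdots)\ast y\approx y$ with $m$ occurrences of $y$ on the left-hand side. An algebra is subdirectly irreducible if the intersection of all its non-trivial congruences (congruences different from equality) is non-trivial; for a module this means that it has a smallest non-zero submodule. Construction $\mathcal{SIQ}(A,t,C)$: let $A$ be a subdirectly irreducible $\mathbb{Z}[t,t^{-1}]$-module such that $\varphi\colon a\mapsto(1-t)\cdot a$ is a non-injective endomorphism of $A$. A set $C\subseteq A$ is admissible if its distinct elements lie in distinct cosets of $\varphi(A)$ in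 $A$ and $C\cup\varphi(A)$ generates $A$. Then $\mathcal{SIQ}(A,t,C)$ is the disjoint union $A\cup(\varphi(A)\times C)$ with the operation $a\ast b=\varphi(a)+t\cdot b$ for $a,b\in A$; $(a,i)\ast(b,j)=(\varphi(a+i-j)+t\cdot b,j)$ for $a,b\in\varphi(A)$, $i,j\in C$; $(a,i)\ast b=a+t\cdot b+i$ for $a\in\varphi(A)$, $i\in C$, $b\in A$; $a\ast(b,j)=(\varphi(\varphi(a)-j)+t\cdot b,j)$ for $a\in A$, $b\in\varphi(A)$, $j\in C$; and with $\backslash$ the left division with respect to $\ast$ ($x\backslash y$ is the unique $z$ with $x\ast z=y$). Modules over the quotient ring $\mathbb{Z}[t,t^{-1}]/(1-t)^{m-1}$ are regarded as $\mathbb{Z}[t,t^{-1}]$-modules annihilated by $(1-t)^{m-1}$. *)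

(* Defs.v *)
From HB Require Import structures.
From mathcomp Require Import all_boot all_order all_algebra.
From mathcomp Require Import all_classical.

Set Implicit Arguments.
Unset Strict Implicit.
Unset Printing Implicit Defensive.
Import GRing.Theory.

Local Open Scope classical_set_scope.
Local Open Scope ring_scope.

(* The signature (Q, *, \) of quandles; [ldiv x y] is x \ y. *)
Record binar2 := Binar2 {
  carrier :> Type;
  op : carrier -> carrier -> carrier;
  ldiv : carrier -> carrier -> carrier }.

Declare Scope quandle_scope.
Local Open Scope quandle_scope.
Notation "x ∗ y" := (op x y) (at level 40, left associativity) : quandle_scope.
Notation "x ⧵ y" := (ldiv x y) (at level 40, left associativity) : quandle_scope.

Definition quandle (Q : binar2) : Prop :=
  [/\ forall x : Q, x ∗ x = x,
      forall x y z : Q, x ∗ (y ∗ z) = (x ∗ y) ∗ (x ∗ z),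
      forall x y : Q, x ⧵ (x ∗ y) = y
    & forall x y : Q, x ∗ (x ⧵ y) = y].

Definition medial (Q : binar2) : Prop :=
  [/\ forall x y u v : Q, (x ∗ y) ∗ (u ∗ v) = (x ∗ u) ∗ (y ∗ v),
      forall x y u v : Q, (x ⧵ y) ⧵ (u ⧵ v) = (x ⧵ u) ⧵ (y ⧵ v)
    & forall x y u v : Q, (x ⧵ y) ∗ (u ⧵ v) = (x ∗ u) ⧵ (y ∗ v)].

Definition projection_quandle (Q : binar2) : Prop :=
  quandle Q /\ forall x y : Q, x ∗ y = y.

Definition reductive (m : nat) (Q : binar2) : Prop :=
  forall x y : Q, iter m (fun z => z ∗ y) x = y.

Definition congruence (Q : binar2) (r : Q -> Q -> Prop) : Prop :=
  [/\ forall x, r x x,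
      forall x y, r x y -> r y x,
      forall x y z, r x y -> r y z -> r x z,
      forall x x' y y', r x x' -> r y y' -> r (x ∗ y) (x' ∗ y')
    & forall x x' y y', r x x' -> r y y' -> r (x ⧵ y) (x' ⧵ y')].

Definition nontrivial_rel (T : Type) (r : T -> T -> Prop) : Prop :=
  ~ (forall x y, r x y <-> x = y).

(* An algebra with at most one element has no non-trivial congruence; the
   empty intersection is then the total relation, which is trivial, so such
   an algebra is not subdirectly irreducible. *)
Definition subdirectly_irreducible (Q : binar2) : Prop :=
  nontrivial_rel (fun x y : Q =>
    forall r, congruence r -> nontrivial_rel r -> r x y).

Definition isomorphic (P Q : binar2) : Prop :=
  exists f : P -> Q, [/\ bijective f,
    forall x y, f (x ∗ y) = f x ∗ f y
  & forall x y, f (x ⧵ y) = f x ⧵ f y].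

(* Z[t, t^-1], as the subring of Q(t) of the fractions p / t^n. *)
Local Notation Qt := {fraction {poly int}}.

Definition laurent_pred : {pred Qt} := fun x =>
  `[< exists p n, x = FracField.tofrac p / FracField.tofrac 'X ^+ n >].

Lemma tofracX_neq0 : FracField.tofrac ('X : {poly int}) != 0.
Proof. by rewrite tofrac_eq0 polyX_eq0. Qed.

Lemma laurent_subring : subring_closed laurent_pred.
Proof.
have nzX n : FracField.tofrac ('X : {poly int}) ^+ n != 0.
  by rewrite expf_neq0 ?tofracX_neq0.
split=> [|x y /asboolP[p [n ->]] /asboolP[q [k ->]]
         |x y /asboolP[p [n ->]] /asboolP[q [k ->]]]; apply/asboolP.
- by exists 1, 0%N; rewrite tofrac1 expr0 divr1.
- exists (p * 'X^k - q * 'X^n), (n + k)%N.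
  by rewrite -mulNr addf_div // tofracB !tofracM !tofracXn exprD mulNr.
- by exists (p * q), (n + k)%N; rewrite mulf_div tofracM exprD.
Qed.

HB.instance Definition _ :=
  GRing.isSubringClosed.Build Qt laurent_pred laurent_subring.

Record laurent := Laurent { laurent_val :> Qt; _ : laurent_val \in laurent_pred }.
HB.instance Definition _ := [isSub for laurent_val].
HB.instance Definition _ := [Choice of laurent by <:].
HB.instance Definition _ := [SubChoice_isSubComNzRing of laurent by <:].

Lemma laurent_t_subproof : FracField.tofrac 'X \in laurent_pred.
Proof. by apply/asboolP; exists 'X, 0%N; rewrite expr0 divr1. Qed.
Definition t : laurent := Laurent laurent_t_subproof.

Lemma laurent_tV_subproof : (FracField.tofrac 'X)^-1 \in laurent_pred.
Proof. by apply/asboolP; exists 1, 1%N; rewrite tofrac1 expr1 mul1r. Qed.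
Definition tV : laurent := Laurent laurent_tV_subproof.

Lemma mul_tV : t * tV = 1.
Proof. by apply: val_inj; rewrite rmorphM rmorph1 /= mulfV ?tofracX_neq0. Qed.

Section Modules.
Variable A : lmodType laurent.

Definition submodule (M : set A) : Prop := submod_closed [in M].

Definition si_module : Prop :=
  exists M : set A, [/\ submodule M, M <> [set 0]
    & forall N : set A, submodule N -> N <> [set 0] -> M `<=` N].

Definition phi (a : A) : A := (1 - t) *: a.

Definition admissible (C : set A) : Prop :=
  set_inj C (fun c => [set c + x | x in range phi]) /\
  smallest submodule (C `|` range phi) = setT.

Lemma phi_addt x b : b \in range phi -> phi x + t *: b \in range phi.
Proof.
rewrite !inE => -[b' _ <-]; exists (x + t *: b') => //.
by rewrite /phi scalerDr !scalerA mulrC.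
Qed.

Lemma phi_subtV x b : b \in range phi -> tV *: (b - phi x) \in range phi.
Proof.
rewrite !inE => -[b' _ <-]; exists (tV *: (b' - x)) => //.
by rewrite /phi -scalerBr !scalerA mulrC.
Qed.

Variable C : set A.

Definition SIQ_carrier : Type := (A + (range phi * C))%type.

Definition SIQ_op (x y : SIQ_carrier) : SIQ_carrier :=
  match x, y with
  | inl a, inl b => inl (phi a + t *: b)
  | inr (a, i), inr (b, j) =>
      inr (exist _ (phi (\val a + \val i - \val j) + t *: \val b)
                   (phi_addt _ (valP b)), j)
  | inr (a, i), inl b => inl (\val a + t *: b + \val i)
  | inl a, inr (b, j) =>
      inr (exist _ (phi (phi a - \val j) + t *: \val b)
                   (phi_addt _ (valP b)), j)
  end.

Definition SIQ_ldiv (x y : SIQ_carrier) : SIQ_carrier :=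
  match x, y with
  | inl a, inl b => inl (tV *: (b - phi a))
  | inr (a, i), inr (b, j) =>
      inr (exist _ (tV *: (\val b - phi (\val a + \val i - \val j)))
                   (phi_subtV _ (valP b)), j)
  | inr (a, i), inl b => inl (tV *: (b - \val a - \val i))
  | inl a, inr (b, j) =>
      inr (exist _ (tV *: (\val b - phi (phi a - \val j)))
                   (phi_subtV _ (valP b)), j)
  end.

Definition SIQ : binar2 := Binar2 SIQ_op SIQ_ldiv.

Lemma scale_tK (b : A) : tV *: (t *: b) = b.
Proof. by rewrite scalerA mulrC mul_tV scale1r. Qed.

Lemma scale_tVK (b : A) : t *: (tV *: b) = b.
Proof. by rewrite scalerA mul_tV scale1r. Qed.

(* [SIQ_ldiv] is the left division of [SIQ_op]. *)
Lemma SIQ_ldivP (x y z : SIQ) : x ∗ z = y <-> z = x ⧵ y.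
Proof.
split=> [<-|->]; case: x => [a|[a i]].
- case: z => [b|[b j]] /=; first by rewrite addrC addKr scale_tK.
  by congr (inr (_, _)); apply: val_inj; rewrite /= addrC addKr scale_tK.
- case: z => [b|[b j]] /=; first by rewrite addrAC addrK addrC addKr scale_tK.
  by congr (inr (_, _)); apply: val_inj; rewrite /= addrC addKr scale_tK.
- case: y => [b|[b j]] /=; first by rewrite scale_tVK addrC subrK.
  by congr (inr (_, _)); apply: val_inj; rewrite /= scale_tVK addrC subrK.
- case: y => [b|[b j]] /=; first by rewrite scale_tVK -addrA subrK addrC subrK.
  by congr (inr (_, _)); apply: val_inj; rewrite /= scale_tVK addrC subrK.
Qed.

End Modules.

Arguments phi {A} a.
Arguments SIQ A C : clear implicits.

(* Main.v *)
(* The displacement group A of Q, generated by the L_x L_y^-1, is abelian because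
   Q is medial, and conjugation by any L_e makes it a Z[t,t^-1]-module on which
   m-reductivity says (1-t)^(m-1) = 0. Put K = ker phi and d x = L_x L_e^-1. For
   each orbit, moving its points by elements of K and fixing all other points is
   a congruence. Two such congruences for distinct orbits meet trivially, so K
   acts nontrivially on just one orbit X, the one that contains the monolith.
   Stabilisers lie in K, so A acts regularly on X; choosing e in X identifies X
   with A. Off X, identifying points with equal left translations is a
   congruence that meets the monolith trivially, so d is injective there and
   embeds the complement of X in A as a union of cosets of phi(A). A transversal
   C of these cosets gives the copies of phi(A) indexed by C. *)
From HB Require Import structures.
Require Import Defs.
From mathcomp Require Import all_boot all_order all_algebra.
From mathcomp Require Import all_classical.

Local Open Scope classical_set_scope.
Local Open Scope ring_scope.

Import GRing.Theory.
Local Open Scope quandle_scope.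

Set Implicit Arguments.
Unset Strict Implicit.
Unset Printing Implicit Defensive.

(** * Laurent modules from an additive automorphism *)

Section LaurentModule.
Variables (V : zmodType) (f g : {additive V -> V}).
Hypotheses (fK : cancel f g) (gK : cancel g f).

Lemma iter_additive (h : {additive V -> V}) n : {morph iter n h : u v / u + v}.
Proof. by move=> u v; elim: n => //= n ->; rewrite raddfD. Qed.

Lemma iter_fK n : cancel (iter n f) (iter n g).
Proof. by move=> v; elim: n => //= n IH; rewrite -iterS iterSr fK. Qed.

Lemma iter_gK n : cancel (iter n g) (iter n f).
Proof. by move=> v; elim: n => //= n IH; rewrite -iterS iterSr gK. Qed.

Definition poly_act (p : {poly int}) (v : V) : V :=
  \sum_(i < size p) iter i f v *~ p`_i.

(** Sizes of sums and products are only bounded, so comparing actions of different polynomials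
    requires a common number of terms. *)
Lemma poly_act_wide n (p : {poly int}) v : (size p <= n)%N ->
  poly_act p v = \sum_(i < n) iter i f v *~ p`_i.
Proof.
move=> le_pn; rewrite /poly_act.
rewrite (big_ord_widen n (fun i => iter i f v *~ p`_i)) // big_mkcond.
apply: eq_bigr => i _.
by case: ltnP => // le_pi; rewrite nth_default.
Qed.

Lemma poly_actDl p q v : poly_act (p + q) v = poly_act p v + poly_act q v.
Proof.
rewrite !(@poly_act_wide (maxn (size p) (size q))) ?leq_maxl ?leq_maxr ?size_polyD //.
by rewrite -big_split; apply: eq_bigr => i _; rewrite coefD mulrzDr.
Qed.

Lemma poly_actDr p : {morph poly_act p : u v / u + v}.
Proof.
move=> u v; rewrite /poly_act -big_split.
by apply: eq_bigr => i _; rewrite iter_additive mulrzDl.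
Qed.

Lemma poly_actC c v : poly_act c%:P v = v *~ c.
Proof. by rewrite (@poly_act_wide 1) ?size_polyC_leq1 // big_ord1 coefC. Qed.

Lemma poly_act_f p v : poly_act p (f v) = f (poly_act p v).
Proof.
by rewrite raddf_sum; apply: eq_bigr => i _; rewrite -iterSr raddfMz.
Qed.

Lemma poly_actMX p v : poly_act (p * 'X) v = f (poly_act p v).
Proof.
rewrite (@poly_act_wide (size p).+1); last first.
  by rewrite (leq_trans (size_polyMleq _ _)) // size_polyX addn2.
rewrite big_ord_recl coefMX /= mulr0z add0r -poly_act_f.
by apply: eq_bigr => i _; rewrite coefMX -iterSr.
Qed.

Lemma poly_actM p q v : poly_act (p * q) v = poly_act p (poly_act q v).
Proof.
elim/poly_ind: p => [|p c IH].
  by rewrite mul0r -[in RHS]polyC0 -[in LHS]polyC0 !poly_actC !mulr0z.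
rewrite mulrDl mulrAC !poly_actDl !poly_actMX IH poly_actC; congr (_ + _).
rewrite mul_polyC (@poly_act_wide (size q)) ?size_scale_leq // /poly_act.
by rewrite mulrz_suml; apply: eq_bigr => i _; rewrite coefZ mulrC mulrzA.
Qed.

Lemma poly_actMXn p n v : poly_act (p * 'X^n) v = iter n f (poly_act p v).
Proof.
elim: n => [|n IH] /=; first by rewrite expr0 mulr1.
by rewrite exprSr mulrA poly_actMX IH.
Qed.

Lemma poly_actXn n v : poly_act 'X^n v = iter n f v.
Proof. by rewrite -['X^n]mul1r poly_actMXn -[1]polyC1 poly_actC. Qed.

Lemma laurent_fraction (r : laurent) : exists pn : {poly int} * nat,
  \val r = FracField.tofrac pn.1 / FracField.tofrac 'X ^+ pn.2.
Proof. by have /asboolP[p [n ->]] := valP r; exists (p, n). Qed.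

Definition laurent_act (r : laurent) (v : V) : V :=
  let pn := sval (cid (laurent_fraction r)) in iter pn.2 g (poly_act pn.1 v).

(** The action does not depend on the fraction chosen: cross-multiplying gives
    [p * 'X^k = q * 'X^n], and applying [f] [n + k] times clears both denominators. *)
Lemma laurent_actE (r : laurent) p n v :
    \val r = FracField.tofrac p / FracField.tofrac 'X ^+ n ->
  laurent_act r v = iter n g (poly_act p v).
Proof.
rewrite /laurent_act; case: cid => -[q k] /= -> /eqP.
have nzX i : FracField.tofrac ('X : {poly int}) ^+ i != 0.
  by rewrite expf_neq0 ?tofracX_neq0.
rewrite eqr_div // -!tofracXn -!tofracM tofrac_eq => /eqP eq_pq.
apply: (can_inj (iter_fK n)); apply: (can_inj (iter_fK k)).
rewrite iter_gK -iterD addnC iterD iter_gK.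
by rewrite -!poly_actMXn eq_pq.
Qed.

Lemma laurent_act_t v : laurent_act t v = f v.
Proof.
rewrite (@laurent_actE _ 'X 0) ?expr0 ?divr1 //=.
by rewrite -['X]mul1r poly_actMX -[1]polyC1 poly_actC.
Qed.

Lemma laurent_actA a b v :
  laurent_act a (laurent_act b v) = laurent_act (a * b) v.
Proof.
have [[p n] /= Ea] := laurent_fraction a.
have [[q k] /= Eb] := laurent_fraction b.
rewrite (laurent_actE _ Ea) (laurent_actE _ Eb).
rewrite (@laurent_actE _ (p * q) (n + k)); last first.
  by rewrite rmorphM /= Ea Eb mulf_div tofracM exprD.
rewrite iterD; congr (iter n g _); rewrite poly_actM.
apply: (can_inj (iter_fK k)); rewrite iter_gK.
by rewrite -poly_actMXn poly_actM poly_actXn iter_gK.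
Qed.

Lemma laurent_act1 : left_id 1 laurent_act.
Proof.
move=> v; rewrite (@laurent_actE _ 1 0) ?rmorph1 ?tofrac1 ?expr0 ?divr1 //=.
by rewrite -[1]polyC1 poly_actC.
Qed.

Lemma laurent_actDr : right_distributive laurent_act +%R.
Proof. by move=> r u v; rewrite /laurent_act poly_actDr iter_additive. Qed.

Lemma laurent_actDl v : {morph laurent_act^~ v : a b / a + b}.
Proof.
move=> a b /=.
have [[p n] /= Ea] := laurent_fraction a.
have [[q k] /= Eb] := laurent_fraction b.
rewrite (laurent_actE _ Ea) (laurent_actE _ Eb).
have nzX i : FracField.tofrac ('X : {poly int}) ^+ i != 0.
  by rewrite expf_neq0 ?tofracX_neq0.
rewrite (@laurent_actE _ (p * 'X^k + q * 'X^n) (n + k)); last first.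
  by rewrite rmorphD /= Ea Eb addf_div // tofracD !tofracM !tofracXn exprD.
rewrite poly_actDl !poly_actMXn iter_additive; congr (_ + _).
  by rewrite iterD iter_fK.
by rewrite addnC iterD iter_fK.
Qed.

(* The proofs [fK] and [gK] are phantom arguments from which the scaling by [t]
   is inferred. *)
Definition laurent_module of cancel f g & cancel g f : Type := V.
HB.instance Definition _ := GRing.Zmodule.on (laurent_module fK gK).
HB.instance Definition _ :=
  GRing.Zmodule_isLmodule.Build laurent (laurent_module fK gK)
    laurent_actA laurent_act1 laurent_actDr laurent_actDl.

Lemma laurent_tE (v : laurent_module fK gK) : t *: v = f v.
Proof. exact: laurent_act_t. Qed.

End LaurentModule.


(* Over a displacement group with scaling conjugation by L_e, [d x] stands for
   L_x L_e^-1. *)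
Record displacement_action (Q : binar2) (A : lmodType laurent)
    (act : A -> Q -> Q) (d : Q -> A) (e : Q) : Prop := DisplacementAction {
  act0 : forall x, act 0 x = x;
  actD : forall a b x, act (a + b) x = act a (act b x);
  act_faithful : forall a, (forall x, act a x = x) -> a = 0;
  op_act : forall x y, x ∗ y = act (d x - d y) y;
  d_act : forall a x, d (act a x) = phi a + d x;
  d_base : d e = 0;
  d_gen : forall P : A -> Prop, P 0 -> (forall a b, P a -> P b -> P (a - b)) ->
    (forall x, P (d x)) -> forall a, P a }.

(** * The displacement group of a medial quandle *)

Section Displacements.
Variable Q : binar2.
Hypotheses (hQ : quandle Q) (hmed : medial Q).

Let idem (x : Q) : x ∗ x = x. Proof. by case: hQ. Qed.
Let op_distr (x y z : Q) : x ∗ (y ∗ z) = (x ∗ y) ∗ (x ∗ z).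
Proof. by case: hQ. Qed.
Let opK (x y : Q) : x ⧵ (x ∗ y) = y. Proof. by case: hQ. Qed.
Let ldivK (x y : Q) : x ∗ (x ⧵ y) = y. Proof. by case: hQ. Qed.
Let op_medial (x y u v : Q) : (x ∗ y) ∗ (u ∗ v) = (x ∗ u) ∗ (y ∗ v).
Proof. by case: hmed. Qed.

Let opIl (x y z : Q) : x ∗ y = x ∗ z -> y = z.
Proof. by move=> eq_xyz; rewrite -(opK x y) eq_xyz opK. Qed.

Let op_ldiv (x y z : Q) : x ∗ (y ⧵ z) = (x ∗ y) ⧵ (x ∗ z).
Proof. by apply: (@opIl (x ∗ y)); rewrite -op_distr !ldivK. Qed.

Let ldiv_op (x y z : Q) : x ⧵ (y ∗ z) = (x ⧵ y) ∗ (x ⧵ z).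
Proof. by apply: (@opIl x); rewrite ldivK op_distr !ldivK. Qed.

Let ldiv_ldiv (x y z : Q) : x ⧵ (y ⧵ z) = (x ⧵ y) ⧵ (x ⧵ z).
Proof. by apply: (@opIl x); rewrite ldivK op_ldiv !ldivK. Qed.

(** Writing [L_x] for left multiplication by [x], apply [L_y] to both sides; distributivity then
    turns the claim into mediality. *)
Lemma op_ldiv_swap (x y u z : Q) : x ∗ (y ⧵ (u ∗ z)) = u ∗ (y ⧵ (x ∗ z)).
Proof. by apply: (@opIl y); rewrite !(op_distr y) !ldivK op_medial. Qed.

(** Two swaps make the generators [L_x L_y^-1] and [L_u L_v^-1] commute. *)
Lemma displacement_swap (x y u v z : Q) :
  x ∗ (y ⧵ (u ∗ (v ⧵ z))) = u ∗ (v ⧵ (x ∗ (y ⧵ z))).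
Proof.
rewrite op_ldiv_swap; congr (u ∗ _); apply: (@opIl y).
by rewrite ldivK op_ldiv_swap ldivK.
Qed.

(** Products of generators already form a group, since the inverse of [L_x L_y^-1] is the generator
    [L_y L_x^-1]. *)
Inductive displacement : (Q -> Q) -> Prop :=
| displacement_id : displacement id
| displacement_step x y f :
    displacement f -> displacement (fun z => x ∗ (y ⧵ f z)).

Lemma displacement_comp f g :
  displacement f -> displacement g -> displacement (f \o g).
Proof.
by move=> df dg; elim: df => [|x y {}f _ IH] //;
  apply: (displacement_step x y IH).
Qed.

Lemma displacement_gen x y : displacement (fun z => x ∗ (y ⧵ z)).
Proof. exact: (displacement_step x y displacement_id). Qed.

Lemma displacement_inv f : displacement f ->
  exists2 g, displacement g & cancel f g /\ cancel g f.
Proof.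
elim=> [|x y {}f _ [g dg [fK gK]]].
  by exists id => //; exact: displacement_id.
exists (g \o (fun z => y ∗ (x ⧵ z))).
  by apply: displacement_comp => //; exact: displacement_gen.
by split=> z /=; rewrite ?gK ?opK ?ldivK // opK ldivK fK.
Qed.

Lemma displacement_comm f g : displacement f -> displacement g ->
  f \o g = g \o f.
Proof.
move=> df dg; apply/funext => z /=.
elim: df => //= x y {}f _ ->; elim: dg => //= u v {}g _ IH.
by rewrite displacement_swap IH.
Qed.

Lemma displacement_morph f : displacement f -> {morph f : x y / x ∗ y}.
Proof. by elim=> // u v {}f _ IH x y; rewrite IH ldiv_op op_distr. Qed.

(** [L_e] is an automorphism, so it conjugates a generator into the generator of the images under
    [L_e]. *)
Lemma displacement_conj e f : displacement f ->
  displacement (fun z => e ∗ f (e ⧵ z)).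
Proof.
elim=> [|x y {}f _ IH].
  by rewrite (_ : (fun z => _) = id); [constructor|];
    apply/funext => z; rewrite ldivK.
rewrite (_ : (fun z => _) = fun z => (e ∗ x) ∗ ((e ∗ y) ⧵ (e ∗ f (e ⧵ z)))).
  exact: displacement_step.
by apply/funext => z; rewrite op_distr op_ldiv.
Qed.

Lemma displacement_conjV e f : displacement f ->
  displacement (fun z => e ⧵ f (e ∗ z)).
Proof.
elim=> [|x y {}f _ IH].
  by rewrite (_ : (fun z => _) = id); [constructor|];
    apply/funext => z; rewrite opK.
rewrite (_ : (fun z => _) = fun z => (e ⧵ x) ∗ ((e ⧵ y) ⧵ (e ⧵ f (e ∗ z)))).
  exact: displacement_step.
by apply/funext => z; rewrite ldiv_op ldiv_ldiv.
Qed.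

(** The type records the two hypotheses so that the abelian group structure, which rests on
    mediality, can be inferred from it. *)
Definition dis_group of quandle Q & medial Q : Type :=
  {f : Q -> Q | displacement f}.
Local Notation D := (dis_group hQ hmed).

Definition dis_fun (a : D) : Q -> Q := sval a.

Lemma dis_funP a : displacement (dis_fun a). Proof. exact: svalP. Qed.

Lemma dis_fun_inj : injective dis_fun.
Proof.
case=> f df [g dg]; rewrite /dis_fun /= => eq_fg; move: df; rewrite eq_fg => df.
by congr exist; exact: Prop_irrelevance.
Qed.

Definition dis0 : D := exist _ id displacement_id.
Definition disD (a b : D) : D :=
  exist _ _ (displacement_comp (dis_funP a) (dis_funP b)).
Definition disN (a : D) : D :=
  let w := cid2 (displacement_inv (dis_funP a)) in exist _ (s2val w) (s2valP w).

Lemma disDA : associative disD.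
Proof. by move=> a b c; apply: dis_fun_inj. Qed.
Lemma disDC : commutative disD.
Proof.
by move=> a b; apply: dis_fun_inj; apply: displacement_comm; apply: dis_funP.
Qed.
Lemma dis0D : left_id dis0 disD.
Proof. by move=> a; apply: dis_fun_inj. Qed.
Lemma disND : left_inverse dis0 disN disD.
Proof.
move=> a; apply: dis_fun_inj; apply/funext => z.
by rewrite /disN /=; case: cid2 => g dg [fK gK] /=; rewrite /dis_fun /= fK.
Qed.

HB.instance Definition _ := gen_eqMixin D.
HB.instance Definition _ := gen_choiceMixin D.
HB.instance Definition _ := GRing.isZmodule.Build D disDA disDC dis0D disND.

Definition dis_gen x y : D := exist _ _ (displacement_gen x y).

Variable e : Q.
Definition dis_conj (a : D) : D := exist _ _ (displacement_conj e (dis_funP a)).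
Definition dis_conjV (a : D) : D := exist _ _ (displacement_conjV e (dis_funP a)).

Lemma dis_conj_nmod : nmod_morphism dis_conj.
Proof.
split=> [|a b]; apply: dis_fun_inj; apply/funext => z; rewrite /dis_fun /=.
  by rewrite ldivK.
by rewrite opK.
Qed.

Lemma dis_conjV_nmod : nmod_morphism dis_conjV.
Proof.
split=> [|a b]; apply: dis_fun_inj; apply/funext => z; rewrite /dis_fun /=.
  by rewrite opK.
by rewrite ldivK.
Qed.

HB.instance Definition _ := GRing.isNmodMorphism.Build D D dis_conj dis_conj_nmod.
HB.instance Definition _ := GRing.isNmodMorphism.Build D D dis_conjV dis_conjV_nmod.

Lemma dis_conjK : cancel dis_conj dis_conjV.
Proof.
by move=> a; apply: dis_fun_inj; apply/funext => z; rewrite /dis_fun /= !opK.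
Qed.

Lemma dis_conjVK : cancel dis_conjV dis_conj.
Proof.
by move=> a; apply: dis_fun_inj; apply/funext => z; rewrite /dis_fun /= !ldivK.
Qed.

Definition dis_module : lmodType laurent := laurent_module dis_conjK dis_conjVK.

Definition dis_coord (x : Q) : dis_module := dis_gen x e.
Definition dis_act (a : dis_module) (x : Q) : Q := dis_fun a x.

(** Idempotence makes [L_y] fix [y], so [L_x] and [L_x L_y^-1] agree at [y]. A displacement [a] is
    an automorphism, so [L_(a x) = a L_x a^-1]; as [t] conjugates by [L_e], this is [d_act]. *)
Lemma dis_module_action : displacement_action dis_act dis_coord e.
Proof.
have coordB x y : dis_coord x - dis_coord y = dis_gen x y.
  apply/eqP; rewrite subr_eq; apply/eqP; apply: dis_fun_inj; apply/funext => z.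
  by rewrite /dis_fun /= opK.
split=> //.
- by move=> a a1; apply: dis_fun_inj; apply/funext => z; exact: a1.
- by move=> x y; rewrite coordB /dis_act /dis_fun /= -{3}(idem y) opK.
- move=> a x; rewrite /phi scalerBl scale1r addrAC laurent_tE.
  apply/eqP; rewrite eq_sym subr_eq; apply/eqP; apply: dis_fun_inj.
  apply/funext => z; rewrite /dis_act /dis_fun /= opK.
  by rewrite -(displacement_morph (dis_funP a)).
- by apply: dis_fun_inj; apply/funext => z; rewrite /dis_fun /= ldivK.
move=> P P0 PB Pd a; have PD b c : P b -> P c -> P (b + c).
  by move=> Pb Pc; rewrite -[c]opprK -[- c]sub0r; apply/PB/PB.
have [f df] : exists2 f, displacement f & dis_fun a = f.
  by exists (dis_fun a) => //; exact: dis_funP.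
elim: df a => [|x y {}f df IH] a /= Ea.
  by rewrite (_ : a = 0) //; apply: dis_fun_inj.
rewrite (_ : a = dis_gen x y + (exist _ f df : D)); last exact: dis_fun_inj.
by rewrite -coordB; apply: PD; [exact: PB | exact: IH].
Qed.

End Displacements.

Lemma displacement_action_exists (Q : binar2) (e : Q) :
  quandle Q -> medial Q ->
  exists (A : lmodType laurent) (act : A -> Q -> Q) (d : Q -> A),
    displacement_action act d e.
Proof. by move=> hQ hmed; do 3!eexists; exact: (dis_module_action hQ hmed). Qed.

(** * Subdirectly irreducible quandles with nilpotent displacement module *)

Lemma nontrivial_relP (T : Type) (r : T -> T -> Prop) x y :
  r x y -> x <> y -> nontrivial_rel r.
Proof. by move=> rxy neq_xy tr; apply/neq_xy/tr. Qed.

(** One such pair is all that later arguments use of the monolith. *)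
Lemma si_separated (Q : binar2) : subdirectly_irreducible Q ->
  exists x y : Q, x <> y /\ forall r, congruence r -> nontrivial_rel r -> r x y.
Proof.
move=> si; apply: contrapT => no_xy; apply: si => x y; split=> [rxy|-> r []//].
by apply: contrapT => neq_xy; apply: no_xy; exists x, y.
Qed.

Lemma phiD (A : lmodType laurent) : {morph @phi A : a b / a + b}.
Proof. by move=> a b; rewrite /phi scalerDr. Qed.

Lemma phiB (A : lmodType laurent) : {morph @phi A : a b / a - b}.
Proof. by move=> a b; rewrite /phi scalerBr. Qed.

Lemma phiN (A : lmodType laurent) : {morph @phi A : a / - a}.
Proof. by move=> a; rewrite /phi scalerN. Qed.

Lemma phi0 (A : lmodType laurent) : phi (0 : A) = 0.
Proof. exact: scaler0. Qed.

Lemma phi_t (A : lmodType laurent) (a : A) : phi a + t *: a = a.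
Proof. by rewrite /phi scalerBl scale1r subrK. Qed.

(** Translation by [j] turns the affine operation of [A] into the twisted one on the copy of phi(A)
    indexed by [j]. *)
Lemma phi_shift (A : lmodType laurent) (u b j : A) :
  phi u + t *: (b + j) = phi (u - j) + t *: b + j.
Proof. by rewrite -[X in _ = _ + X]phi_t addrACA -phiD subrK -scalerDr. Qed.

Lemma iter_phi (A : lmodType laurent) n (a : A) :
  iter n phi a = (1 - t) ^+ n *: a.
Proof.
by elim: n => [|n IH] /=; rewrite ?expr0 ?scale1r // IH /phi scalerA exprS.
Qed.

(** Take the last non-zero iterate. *)
Lemma nilpotent_ker_phi (A : lmodType laurent) n (a : A) :
  iter n phi a = 0 -> a <> 0 ->
  exists k, iter k phi a <> 0 /\ phi (iter k phi a) = 0.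
Proof.
elim: n a => [|n IH] a //; rewrite iterSr => an0 act0E.
have [pa0|/IH pa] := pselect (phi a = 0); first by exists 0%N.
by have [k [k0 k1]] := pa an0; exists k.+1; rewrite iterSr.
Qed.

(** * The quandle in terms of the action and the coordinate *)

Section Action.
Variables (Q : binar2) (hQ : quandle Q) (A : lmodType laurent).
Variables (act : A -> Q -> Q) (d : Q -> A) (e : Q).
Hypothesis H : displacement_action act d e.

Let act0E := act0 H.
Let aD := actD H.
Let da := d_act H.

Lemma actNK a : cancel (act a) (act (- a)).
Proof. by move=> x; rewrite -aD addNr act0E. Qed.

Lemma actCA a b x : act a (act b x) = act b (act a x).
Proof. by rewrite -!aD addrC. Qed.

(** Seek the quotient as [act b y]: its coordinate is [phi b + d y], so the equation to solve is
    [b - phi b = t *: b = d y - d x]. *)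
Lemma ldiv_act x y : x ⧵ y = act (tV *: (d y - d x)) y.
Proof.
case: hQ => _ _ opK _; set b := _ *: _.
have bE : b = phi b + (d y - d x) by rewrite -[LHS]phi_t scale_tVK.
rewrite -[in LHS](_ : x ∗ act b y = y) ?opK //.
by rewrite (op_act H) da -aD {2}bE (addrA (phi b)) addrA subrK subrr act0E.
Qed.

Lemma d_op x y : d (x ∗ y) = phi (d x) + t *: d y.
Proof. by rewrite (op_act H) da phiB -addrA -{2}(phi_t (d y)) addKr. Qed.

Lemma iter_op n x y :
  iter n.+1 (fun z => z ∗ y) x = act (iter n phi (d x - d y)) y.
Proof.
elim: n => [|n IH]; first by rewrite /= (op_act H).
by rewrite iterS IH (op_act H) da addrK.
Qed.

(** For fixed [y], the [b] such that the (m-1)-st iterate of phi at [b] fixes [y] form a subgroup.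
    By reductivity it contains every [d z - d y], hence every [d x]. One power of phi is lost since
    the first product already moves [y] by [d x - d y] itself. *)
Lemma reductive_nilpotent m : (0 < m)%N -> reductive m Q ->
  forall a : A, iter m.-1 phi a = 0.
Proof.
case: m => // m _ red a; apply: (act_faithful H) => y.
suff ay b : act (iter m phi b) y = y by exact: ay.
move: b; have sub b c : act (iter m phi b) y = y -> act (iter m phi c) y = y ->
    act (iter m phi (b - c)) y = y.
  move=> Eb Ec; rewrite iter_phi scalerBr -!iter_phi addrC aD Eb.
  by rewrite -{1}Ec actNK.
apply: (d_gen H) => // [|x]; first by rewrite iter_phi scaler0 act0E.
have key z : act (iter m phi (d z - d y)) y = y by rewrite -iter_op red.
have -> : d x = (d x - d y) - (d e - d y).
  by rewrite (d_base H) opprB subr0 subrK.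
exact: sub.
Qed.

(** Both operations are expressed by [d] and the action alone. *)
Lemma act_congruence (r : Q -> Q -> Prop) :
  (forall x, r x x) -> (forall x y, r x y -> r y x) ->
  (forall x y z, r x y -> r y z -> r x z) ->
  (forall x y, r x y -> d x = d y) ->
  (forall c x y, r x y -> r (act c x) (act c y)) -> congruence r.
Proof.
move=> rr rs rt rd ra; split=> // x x' y y' /rd dx ry.
  by rewrite !(op_act H) -dx -(rd _ _ ry); exact: ra.
by rewrite !ldiv_act -dx -(rd _ _ ry); exact: ra.
Qed.

Definition orbit z x := exists a, x = act a z.

Lemma orbit_act z c x : orbit z (act c x) <-> orbit z x.
Proof.
split=> -[a E]; first by exists (- c + a); rewrite aD -E actNK.
by exists (c + a); rewrite aD E.
Qed.

(** Elements of ker phi leave [d] unchanged. [N] is all of [A] when singling out the orbit of [e],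
    and an arbitrary non-zero submodule when finding the smallest one. *)
Lemma orbit_congruence (N : A -> Prop) z :
  N 0 -> (forall a b, N a -> N b -> N (a - b)) ->
  congruence (fun x y => x = y \/
    orbit z x /\ exists2 a, N a /\ phi a = 0 & y = act a x).
Proof.
move=> N0 NB; have NN a : N a -> N (- a) by rewrite -sub0r; exact: NB.
have ND a b : N a -> N b -> N (a + b).
  by move=> Na Nb; rewrite -[b]opprK; apply/NB/NN.
apply: act_congruence.
- by left.
- move=> x y [->|[ox [a [Na pa] ->]]]; [by left | right].
  split; first exact/orbit_act.
  by exists (- a); rewrite ?actNK // phiN pa oppr0; split=> //; exact: NN.
- move=> x y y' [<-//|[ox [a [Na pa] ->]]] [<-|[_ [b [Nb pb] ->]]]; right.
    by split=> //; exists a.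
  split=> //; exists (b + a); rewrite ?aD // phiD pa pb addr0.
  by split=> //; exact: ND.
- by move=> x y [->//|[_ [a [_ pa] ->]]]; rewrite da pa add0r.
move=> c x y [->|[ox [a Na ->]]]; [by left | right].
by split; [exact/orbit_act | exists a; rewrite // actCA].
Qed.

Lemma coord_congruence z :
  congruence (fun x y => x = y \/ [/\ ~ orbit z x, ~ orbit z y & d x = d y]).
Proof.
apply: act_congruence.
- by left.
- by move=> x y [->|[ox oy E]]; [left | right].
- move=> x y w [->//|[ox oy E]] [<-|[_ ow E']]; right; first by split.
  by rewrite E E'.
- by move=> x y [->|[]].
move=> c x y [->|[ox oy E]]; [by left | right].
by split; rewrite ?orbit_act // !da E.
Qed.

(** * Consequences of a pair identified by all non-trivial congruences *)

Section Monolith.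
Variable q : Q.
Hypothesis neq_eq : e <> q.
Hypothesis monolith : forall r, congruence r -> nontrivial_rel r -> r e q.
Variable n : nat.
Hypothesis nilp : forall a : A, iter n phi a = 0.
Hypothesis A_neq0 : exists a : A, a <> 0.

(* Applies the monolith to the congruence moving points only inside the orbit
   of [z] and only by elements of ker phi. *)
Lemma ker_phi_orbit a z : phi a = 0 -> act a z <> z -> orbit z e.
Proof.
move=> pa az.
have [|//|[]//] :=
  monolith (@orbit_congruence (fun=> True) z I (fun _ _ _ _ => I)).
apply: (@nontrivial_relP _ _ z (act a z)); last by move/esym.
by right; split; [exists 0; rewrite act0E | exists a].
Qed.

Lemma ker_phi_fix a z : phi a = 0 -> ~ orbit e z -> act a z = z.
Proof.
move=> pa oz; apply: contrapT => /(ker_phi_orbit pa) [b E].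
by apply: oz; exists (- b); rewrite E actNK.
Qed.

(** Comparing coordinates puts [a] in ker phi. It then fixes the orbit of [e] by commutativity and
    all other points by [ker_phi_fix], so faithfulness applies. *)
Lemma act_free a : act a e = e -> a = 0.
Proof.
move=> ae; apply: (act_faithful H) => x.
have pa : phi a = 0 by apply: (addIr (d e)); rewrite -da ae add0r.
have [[b ->]|ox] := pselect (orbit e x); first by rewrite actCA ae.
exact: ker_phi_fix.
Qed.

Lemma act_inj : injective (act^~ e).
Proof.
move=> a b /= E; apply/eqP; rewrite -subr_eq0; apply/eqP/act_free.
by rewrite addrC aD E actNK.
Qed.

(** Otherwise [coord_congruence] is non-trivial and relates [e] to [q], but [e] lies in its own
    orbit and is related only to itself. *)
Lemma coord_inj x y : ~ orbit e x -> ~ orbit e y -> d x = d y -> x = y.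
Proof.
move=> ox oy E; apply: contrapT => neq_xy.
have [|//|[oe _ _]] := monolith (@coord_congruence e).
  by apply: nontrivial_relP neq_xy; right.
by apply: oe; exists 0; rewrite act0E.
Qed.

Lemma phi_not_inj : ~ injective (@phi A).
Proof.
case: A_neq0 => a a_neq0 inj_phi.
have [k [k0 k1]] := nilpotent_ker_phi (nilp a) a_neq0.
by apply/k0/inj_phi; rewrite k1 phi0.
Qed.

Lemma submoduleP (N : set A) : submodule N ->
  [/\ N 0, forall a b, N a -> N b -> N (a - b) & forall r a, N a -> N (r *: a)].
Proof.
move=> [/set_mem N0 NL]; have NZ r a : N a -> N (r *: a).
  move=> Na; rewrite -[_ *: _]addr0.
  by apply/set_mem/NL; apply/mem_set.
split=> // a b Na Nb; rewrite addrC -scaleN1r.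
by apply/set_mem/NL; apply/mem_set.
Qed.

(** A non-zero submodule [N] meets ker phi, so its orbit congruence relates [e] to [q]. Freeness at
    [e] makes the [b] with [q = act b e] unique; it lies in every such [N], so their intersection is
    non-zero. *)
Lemma module_si : si_module A.
Proof.
have [a0 a0_neq0] := A_neq0.
have ker_meet (N : set A) : submodule N -> N <> [set 0] ->
    exists2 a, N a /\ phi a = 0 & a <> 0.
  move=> sN neqN; have [N0 NB NZ] := submoduleP sN.
  have [a Na a_neq0] : exists2 a, N a & a <> 0.
    apply: contrapT => no_a; apply: neqN; apply/seteqP; split=> [a Na|_ ->] //.
    by apply: contrapT => a_neq0; apply: no_a; exists a.
  have [k [k0 k1]] := nilpotent_ker_phi (nilp a) a_neq0.
  by exists (iter k phi a); rewrite // iter_phi; split;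
    [exact: NZ | rewrite -iter_phi].
have mono (N : set A) : submodule N -> N <> [set 0] ->
    exists2 a, N a & q = act a e.
  move=> sN neqN; have [N0 NB _] := submoduleP sN.
  have [a [Na pa] a_neq0] := ker_meet N sN neqN.
  have [|//|[_ [b [Nb _] ->]]] := monolith (@orbit_congruence N e N0 NB);
    last by exists b.
  apply: (@nontrivial_relP _ _ e (act a e)); last by move/esym/act_free.
  by right; split; [exists 0; rewrite act0E | exists a].
have [b _ qb] : exists2 b, setT b & q = act b e.
  apply: mono; first by split=> [|r u v _ _]; apply/mem_set.
  by move=> E; have : [set: A] a0 by []; rewrite E.
have bN (N : set A) : submodule N -> N <> [set 0] -> N b.
  move=> sN neqN; have [c Nc] := mono N sN neqN.
  by rewrite qb => /act_inj ->.
exists [set a | forall N, submodule N -> N <> [set 0] -> N a]; split.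
- split=> [|r u v /set_mem Mu /set_mem Mv]; apply/mem_set => N sN neqN.
    by case: (submoduleP sN).
  have [N0 NB NZ] := submoduleP sN.
  rewrite -[v]opprK -[- v]sub0r; apply: (NB); first exact: NZ (Mu N sN neqN).
  by apply: (NB); [exact: N0 | exact: Mv].
- move=> /seteqP[/(_ b bN) b0 _]; apply: neq_eq.
  by rewrite qb b0 act0E.
- by move=> N sN neqN a; exact.
Qed.


(** * A transversal of the cosets of phi(A) *)

Definition coset_repr (a : A) : A := xget 0 [set b | range phi (a - b)].

Lemma coset_reprP a : range phi (a - coset_repr a).
Proof.
(* The coset contains [a] itself, so the default 0 is never returned. *)
apply: (@xgetPex _ 0 [set b | range phi (a - b)]).
by exists a, 0; rewrite // phi0 subrr.
Qed.

(** Congruent elements define the same set, from which [xget] makes the same choice. *)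
Lemma coset_repr_eq a b : range phi (a - b) -> coset_repr a = coset_repr b.
Proof.
move=> [u _ Eu]; congr (xget 0 _); apply/seteqP; split=> c [w _ Ew] /=.
  by exists (w - u); rewrite // phiB Ew Eu opprB addrC addrA subrK.
by exists (w + u); rewrite // phiD Ew Eu addrC addrA subrK.
Qed.

Definition off_orbit : set A := [set d x | x in [set x | ~ orbit e x]].
Definition coset_reprs : set A := coset_repr @` off_orbit.
Local Notation C := coset_reprs.

(** [act c] shifts [d] by [phi c] and preserves orbits. *)
Lemma off_orbitD a b : off_orbit a -> range phi b -> off_orbit (b + a).
Proof.
by case=> x ox <- [c _ <-]; exists (act c x); rewrite ?da //= orbit_act.
Qed.

Lemma coset_reprs_off a : C a -> off_orbit a.
Proof.
case=> b Db <-; have [c _ Ec] := coset_reprP b.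
rewrite -[coset_repr b](subrK b); apply: off_orbitD => //.
by exists (- c); rewrite // phiN Ec opprB.
Qed.

Lemma coset_repr_id a : C a -> coset_repr a = a.
Proof.
case=> b _ <-; apply/coset_repr_eq; have [c _ Ec] := coset_reprP b.
by exists (- c); rewrite // phiN Ec opprB.
Qed.

Lemma coset_reprs_inj i j : C i -> C j -> range phi (i - j) -> i = j.
Proof. by move=> Ci Cj /coset_repr_eq; rewrite !coset_repr_id. Qed.

Lemma coset_reprs_admissible : admissible C.
Proof.
split.
  move=> i j /set_mem Ci /set_mem Cj E; apply: coset_reprs_inj => //.
  have : [set i + x | x in range phi] i.
    by exists 0; rewrite ?addr0 //; exists 0; rewrite ?phi0.
  by rewrite E => -[x rx <-]; rewrite addrC addKr.
apply/seteqP; split=> // a _ N /= [/submoduleP[N0 NB _] sub].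
(* It suffices to reach the coordinates [d x]: on the orbit of [e] they lie in phi(A) because
   [d e = 0], elsewhere they differ from a representative by an element of phi(A). *)
move: a; apply: (d_gen H) => // x.
have Np b : range phi b -> N b by move=> rb; apply: sub; right.
have [[a ->]|ox] := pselect (orbit e x).
  by rewrite da (d_base H) addr0; apply: Np; exists a.
rewrite -(subrK (coset_repr (d x)) (d x)) -[X in _ + X]opprK; apply: (NB).
  exact/Np/coset_reprP.
by rewrite -sub0r; apply: (NB) => //; apply: sub; left; exists (d x) => //; exists x.
Qed.

(** * The isomorphism with the constructed quandle *)

Lemma SIQ_inr_eq (b b' : range phi) (j j' : C) :
  \val b + \val j = \val b' + \val j' ->
  inr (b, j) = inr (b', j') :> SIQ_carrier C.
Proof.
move=> E; have Ej : j = j'.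
  apply: val_inj; apply: coset_reprs_inj; try exact/set_mem/valP.
  have /set_mem[u _ Eu] := valP b; have /set_mem[u' _ Eu'] := valP b'.
  exists (u' - u); rewrite // phiB Eu Eu'; apply/eqP.
  by rewrite subr_eq addrAC eq_sym subr_eq addrC E addrC.
congr (inr (_, _)) => //; apply: val_inj.
by apply: (addIr (\val j)); rewrite E Ej.
Qed.

(** The graph of the isomorphism, kept as a relation so that [a], [b] and [j] need not be chosen
    before their uniqueness is known. *)
Definition SIQ_rel (x : Q) (w : SIQ_carrier C) : Prop :=
  match w with
  | inl a => x = act a e
  | inr (b, j) => ~ orbit e x /\ d x = \val b + \val j
  end.

Lemma SIQ_rel_total x : exists w, SIQ_rel x w.
Proof.
have [[a xa]|ox] := pselect (orbit e x); first by exists (inl a).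
have rb : d x - coset_repr (d x) \in range phi by exact/mem_set/coset_reprP.
have Cj : coset_repr (d x) \in C by apply/mem_set; exists (d x) => //; exists x.
by exists (inr (SigSub rb, SigSub Cj)); split; rewrite //= subrK.
Qed.

Lemma SIQ_rel_fun x w w' : SIQ_rel x w -> SIQ_rel x w' -> w = w'.
Proof.
case: w w' => [a|[b j]] [a'|[b' j']] //=.
- by move=> -> /act_inj ->.
- by move=> -> [] []; exists a.
- by move=> [ox _] xa; case: ox; exists a'.
by move=> [_ ->] [_]; exact: SIQ_inr_eq.
Qed.

Lemma SIQ_rel_inj x x' w : SIQ_rel x w -> SIQ_rel x' w -> x = x'.
Proof.
case: w => [a -> ->|[b j] [ox Ex] [ox' Ex']] //.
by apply: coord_inj; rewrite // Ex.
Qed.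

Lemma SIQ_rel_onto w : exists x, SIQ_rel x w.
Proof.
case: w => [a|[b j]]; first by exists (act a e).
have Dj := coset_reprs_off (set_mem (valP j)).
by have [x ox Ex] := off_orbitD Dj (set_mem (valP b)); exists x.
Qed.

(** If [y = act b e], its coordinate [phi b] cancels against [b = phi b + t *: b]. Off the orbit of
    [e] only the coordinate matters, and [phi_shift] computes it. *)
Lemma SIQ_rel_op x y w v : SIQ_rel x w -> SIQ_rel y v ->
  SIQ_rel (x ∗ y) (SIQ_op w v).
Proof.
case: w v => [a|[a i]] [b|[b j]] /=.
- move=> -> ->; rewrite (op_act H) !da (d_base H) !addr0 -aD.
  by rewrite -{2}(phi_t b) addrA subrK.
- move=> -> [oy Ey]; split; first by rewrite (op_act H) orbit_act.
  by rewrite d_op da (d_base H) addr0 Ey phi_shift.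
- move=> [_ Ex] ->; rewrite (op_act H) da (d_base H) addr0 Ex -aD; congr (act _ e).
  by rewrite -{2}(phi_t b) addrA subrK addrAC.
- move=> [ox Ex] [oy Ey]; split; first by rewrite (op_act H) orbit_act.
  by rewrite d_op Ex Ey phi_shift.
Qed.

Lemma isomorphic_SIQ : isomorphic Q (SIQ A C).
Proof.
have /choice[f Pf] := SIQ_rel_total.
have fop (x y : Q) : f (x ∗ y) = (f x : SIQ A C) ∗ f y.
  exact: SIQ_rel_fun (SIQ_rel_op (Pf x) (Pf y)).
exists f; split=> //.
- rewrite -setTT_bijective; split=> // [x y _ _ E|w _].
    by apply: (SIQ_rel_inj (Pf x)); rewrite E.
  by have [x xw] := SIQ_rel_onto w; exists x => //; exact: SIQ_rel_fun xw.
(* Left division is determined by the operation, so preserving the latter is enough. *)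
by move=> x y; apply/SIQ_ldivP; rewrite -fop; case: hQ => _ _ _ ->.
Qed.

End Monolith.
End Action.

(** * Subdirectly irreducible projection quandles *)

Lemma projection_si_card (Q : binar2) :
  quandle Q -> (forall x y : Q, x ∗ y = y) ->
  subdirectly_irreducible Q -> ([set: Q] #= `I_2)%card.
Proof.
move=> [_ _ opK _] op_r /si_separated[p [q [neq_pq mono]]].
have ldiv_r (x y : Q) : x ⧵ y = y by rewrite -{1}(op_r x y) opK.
have pq x : x = p \/ x = q.
  have [->|neq_xp] := pselect (x = p); [by left | right].
  (* Every equivalence is a congruence here. This one collapses just [p] and a supposed third
     element [x], so it cannot relate [p] to [q]. *)
  pose r (u v : Q) := u = v \/ (u = p \/ u = x) /\ (v = p \/ v = x).
  have cr : congruence r.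
    split.
    - by left.
    - by move=> u v [->|[]]; [left | right].
    - by move=> u v w [->//|[u1 v1]] [<-|[v2 w1]]; right.
    - by move=> u u' v v' _; rewrite !op_r.
    - by move=> u u' v v' _; rewrite !ldiv_r.
  have rpx : r p x by right; split; [left | right].
  have [//|[_ []]] := mono r cr (nontrivial_relP rpx (fun E => neq_xp (esym E))).
    by move/esym.
  by move/esym.
apply/eq_cardSP; exists p => //; apply/eq_cardSP; exists q.
  by split=> // /esym.
rewrite II0 card_eq0; apply/eqP/seteqP; split=> // x [[_ xp] xq].
by case: (pq x).
Qed.

Theorem corollary7p12 (m : nat) (Q : binar2) (hm : (1 <= m)%N)
  (hQ : quandle Q) (hmed : medial Q) (hred : reductive m Q)
  (hsi : subdirectly_irreducible Q) :
  (m = 1%N -> ([set: Q] #= `I_2)%card) /\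
  ((2 <= m)%N -> ~ projection_quandle Q ->
   exists (A : lmodType laurent) (C : set A),
     [/\ si_module A,
         forall a : A, (1 - t) ^+ (m - 1) *: a = 0,
         ~ injective (@phi A),
         admissible C
       & isomorphic Q (SIQ A C)]).
Proof.
split=> [m1|_ not_proj].
  by apply: projection_si_card => // x y; move: (hred x y); rewrite m1.
have [e [q [neq_eq mono]]] := si_separated hsi.
(* The base point is a member of the monolith pair, so the orbit of [e] is the regular one. *)
have [A [act [d H]]] := displacement_action_exists e hQ hmed.
have nilp := reductive_nilpotent H hm hred.
(* If [A] were zero, every product [act (d x - d y) y] would equal [y]. *)
have A_neq0 : exists a : A, a <> 0.
  apply: contrapT => A0; apply: not_proj; split=> // x y.
  rewrite (op_act H) -[RHS](act0 H); congr act.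
  by apply: contrapT => nz; apply: A0; exists (d x - d y).
exists A, (coset_reprs act d e); split.
- exact: (module_si hQ H neq_eq mono nilp A_neq0).
- by move=> a; rewrite subn1 -iter_phi.
- exact: (phi_not_inj nilp A_neq0).
- exact: (coset_reprs_admissible H).
- exact: (isomorphic_SIQ hQ H neq_eq mono).
Qed.
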